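(* Let $L$ be a finite ranked lattice with rank function $\rho$, and let $(A_1,\dots,A_n)$ be the ordered partition of the atoms of $L$ induced by a multichain $C:\hat{0}=x_0\leq x_1\leq\cdots\leq x_n=\hat{1}$. Suppose that for each $y\in L$ and each $\mathbf{t}\in\mathcal{T}_y^A$ we have $|\operatorname{supp}\mathbf{t}|=\rho(y)$. Then the following are equivalent: (1) for every $x\in L$ with $x\neq\hat{0}$ there is an index $i$ with $|A_i\cap A_x|=1$; (2) for every element $x\in L$ which is the join of two elements of the same block $A_j$, there is an index $i$ with $|A_i\cap A_x|=1$; (3) the multichain $C$ satisfies the meet condition; (4) $\chi(L,t)=t^{\rho(L)-n}\prod_{i=1}^n(t-|A_i|)$.
   Context: The induced partition is $A_i=\{a \text{ an atom of } L: a\leq x_i,\ a\not\leq x_{i-1}\}$ (blocks may be empty). An atomic transversal is a tuple $\mathbf{t}=(t_1,\dots,t_n)$ with $t_i\in A_i\cup\{\hat{0}\}$; $\operatorname{supp}\mathbf{t}$ is the set of indices with $t_i\neq\hat{0}$, and $\mathcal{T}_y^A$ is the set of atomic transversals with $t_1\vee\cdots\vee t_n=y$. $A_x$ is the set of atoms below $x$. An element is atomic if it is a join of atoms. The multichain $C$ satisfies the meet condition if for every atomic $x\in L$ that is neither $\hat{0}$ nor an atom, letting $i$ be the index with $x\leq x_i$ and $x\not\leq x_{i-1}$, we have $x\wedge x_{i-1}\neq\hat{0}$. $\rho(L)$ is the maximum rank, $\mu$ is defined by $\sum_{y\leq x}\mu(y)=\delta_{\hat{0},x}$, and $\chi(L,t)=\sum_{x\in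 L}\mu(x)t^{\rho(L)-\rho(x)}$. *)

(* Defs.v *)
From HB Require Import structures.
From mathcomp Require Export all_boot all_order all_algebra.

Set Implicit Arguments.
Unset Strict Implicit.
Unset Printing Implicit Defensive.

Export Order.TTheory GRing.Theory.
Local Open Scope order_scope.

Section RankedLattice.
Variables (d : Order.disp_t) (L : finTBLatticeType d).
Implicit Types (x y a : L) (rho : L -> nat).

Definition covered : rel L :=
  fun x y => (x < y) && ~~ [exists z : L, (x < z) && (z < y)].

(* The chain itself is x :: s, so that its length is size s. *)
Definition maximal_chain x y (s : seq L) : Prop :=
  path covered x s /\ last x s = y.

(* L is ranked and rho is its rank function: all maximal chains from \bot to x
   have the same length, and this length is rho x (such chains always exist as
   L is finite). *)
Definition rank_function rho : Prop :=
  forall x s, maximal_chain \bot x s -> size s = rho x.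

Definition lattice_rank rho : nat := (\max_(x : L) rho x)%N.

Definition is_atom a : bool := covered \bot a.

Definition atoms_below x : {set L} := [set a | is_atom a & a <= x].

Definition atomic x : Prop :=
  exists S : {set L}, (forall a, a \in S -> is_atom a) /\ x = \join_(a in S) a.

(* k bounds the depth of the recursion; #|L| is enough fuel, see mobius_sum. *)
Fixpoint mobius_rec (k : nat) x : int :=
  if k is k'.+1 then
    ((x == \bot)%:R - \sum_(y : L | (y < x)%O) mobius_rec k' y)%R
  else 0%R.

Definition mobius x : int := mobius_rec #|L| x.

Lemma mobius_rec_stable k m x :
  (#|[set y : L | (y < x)%O]| < k)%N -> (#|[set y : L | (y < x)%O]| < m)%N ->
  mobius_rec k x = mobius_rec m x.
Proof.
elim: k m x => [|k IHk] [|m] x //= ltk ltm; congr (_ - _)%R.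
apply: eq_bigr => y ltyx.
have lt_card : (#|[set z : L | (z < y)%O]| < #|[set z : L | (z < x)%O]|)%N.
  apply: proper_card; apply/properP; split.
    by apply/subsetP=> z; rewrite !inE => /lt_trans; apply.
  by exists y; rewrite !inE // ltxx.
by apply: IHk; apply: leq_trans lt_card _.
Qed.

(* The defining recurrence of the Moebius function. *)
Lemma mobius_sum x : (\sum_(y : L | (y <= x)%O) mobius y = (x == \bot)%:R)%R.
Proof.
have ltL y : (#|[set z : L | (z < y)%O]| < #|L|)%N.
  rewrite -cardsT; apply: proper_card; apply/properP; split; first exact: subsetT.
  by exists y; rewrite !inE // ltxx.
rewrite (bigD1 x) //= {1}/mobius.
rewrite (@mobius_rec_stable _ #|L|.+1) ?ltL //=; last by rewrite ltnW ?ltnS ?ltL.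
rewrite [X in (_ + X)%R](eq_bigl (fun y : L => (y < x)%O)) ?subrK // => y.
by rewrite lt_neqAle andbC.
Qed.

Definition characteristic_poly rho : {poly int} :=
  (\sum_(x : L) mobius x *: 'X^(lattice_rank rho - rho x))%R.

Section Multichain.
Variables (n : nat) (C : 'I_n.+1 -> L).

(* Blocks A_1, ..., A_n are indexed by i : 'I_n, i standing for the index i + 1:
   lower i and upper i are then the elements x_i and x_(i+1) of C. *)
Definition lower (i : 'I_n) : L := C (widen_ord (leqnSn n) i).
Definition upper (i : 'I_n) : L := C (lift ord0 i).

Definition multichain : Prop :=
  [/\ C ord0 = \bot, C ord_max = \top & forall i, lower i <= upper i].

Definition block (i : 'I_n) : {set L} :=
  [set a | is_atom a & (a <= upper i) && ~~ (a <= lower i)].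

Definition supp (t : {ffun 'I_n -> L}) : {set 'I_n} := [set i | t i != \bot].

Definition atomic_transversal (t : {ffun 'I_n -> L}) : bool :=
  [forall i, t i \in \bot |: block i].

(* This is the set T_y^A. *)
Definition transversals y : {set {ffun 'I_n -> L}} :=
  [set t : {ffun 'I_n -> L} | atomic_transversal t & \join_(i < n) t i == y].

Definition has_singleton_block x : Prop :=
  exists i : 'I_n, #|block i :&: atoms_below x| = 1%N.

(* The index i with x <= x_i and x not <= x_(i-1) is unique. *)
Definition meet_condition : Prop :=
  forall x, atomic x -> x != \bot -> ~~ is_atom x ->
  forall i : 'I_n, x <= upper i -> ~~ (x <= lower i) ->
  x `&` lower i != \bot.

End Multichain.
End RankedLattice.

(* Main.v *)
Require Import Defs.
From mathcomp Require Import all_boot all_order all_algebra.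

(* Let S(y) be the sum of (-1)^|supp t| over the transversals t with join y.
   Summing over y <= x, a choice of one atom or none in each block below x, gives
   P(x) = prod_i (1 - |A_i cap A_x|), which vanishes exactly when some block has
   a single atom below x.  As P(bot) = 1, clause (1) says that S = mu, while the
   support hypothesis turns the right-hand side of (4) into
   sum_y S(y) t^(rho(L) - rho(y)).  So (1) implies (4); conversely, at the least
   rank where (1) fails, S - mu = P, and a minimal x violating (1) has all its
   atoms in one block, so that P <= 0 on this rank and the equality of
   coefficients forces P = 0.
   For (3) => (1): a block meeting the atoms below x /\ x_k lies below x_k, hence
   a singleton block for x /\ x_k is one for x. *)

Section FiniteLattice.
Set Implicit Arguments.
Unset Strict Implicit.
Import Num.Theory.
Local Open Scope order_scope.
Variables (d : Order.disp_t) (L : finTBLatticeType d).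
Implicit Types (x y z a b : L).

(** * Induction, chains and atoms in a finite lattice *)

Lemma lt_induction (P : L -> Prop) :
  (forall x, (forall y, y < x -> P y) -> P x) -> forall x, P x.
Proof.
move=> IH x; have [m] := ubnP #|[set y | y < x]|.
elim: m x => // m IHm x ltm; apply: IH => y ltyx; apply: IHm.
rewrite ltnS in ltm; apply: leq_trans ltm; apply: proper_card; apply/properP; split.
  by apply/subsetP=> z; rewrite !inE => /lt_trans; apply.
by exists y; rewrite !inE // ltxx.
Qed.

Lemma exists_maximal_chain z x : z <= x -> exists s, maximal_chain z x s.
Proof.
elim/lt_induction: x => x IH; rewrite le_eqVlt => /predU1P[->|ltzx].
  by exists [::].
(* An element covered by [x] and above [z] is reached by climbing from [z], with induction on the
   number of elements strictly between. *)
have: exists y, (z <= y) && covered y x.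
  have [m] := ubnP #|[set y | z < y < x]|.
  elim: m z ltzx {IH} => // m IHm z ltzx ltm.
  have [/existsP[y /andP[zy yx]]|nzx] := boolP [exists y, (z < y) && (y < x)].
    have [|u /andP[yu ux]] := IHm y yx; last first.
      by exists u; rewrite ux (le_trans (ltW zy)).
    rewrite ltnS in ltm; apply: leq_trans ltm; apply: proper_card; apply/properP; split.
      by apply/subsetP=> u; rewrite !inE => /andP[/(lt_trans zy)-> ->].
    by exists y; rewrite !inE ?ltxx // zy yx.
  by exists z; rewrite lexx /covered ltzx.
case=> y /andP[zy yx]; have [||s [ps ls]] := IH y; [by case/andP: yx | by [] |].
by exists (rcons s x); split; rewrite ?last_rcons // rcons_path ps ls.
Qed.

Lemma atom_below x : x != \bot -> exists2 a, is_atom a & a <= x.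
Proof.
elim/lt_induction: x => x IH xn0.
have [/existsP[y /andP[y0 yx]]|nx] := boolP [exists y, (\bot < y) && (y < x)].
  have [|a aP ay] := IH y yx; first by rewrite -lt0x.
  by exists a => //; apply: le_trans ay (ltW yx).
by exists x => //; rewrite /is_atom /covered lt0x xn0.
Qed.

Lemma atom_neq0 a : is_atom a -> a != \bot.
Proof. by case/andP; rewrite lt0x. Qed.

Lemma atom_le_eq a b : is_atom a -> is_atom b -> a <= b -> a = b.
Proof.
move=> /atom_neq0 a0 /andP[_ /existsPn/(_ a)] + ab.
by rewrite lt0x a0 /= lt_neqAle ab andbT negbK => /eqP.
Qed.

(** Uniqueness in Möbius inversion: by induction the terms below [x] cancel. Sums are compared only
    on the elements below [x], so it applies where clause (1) is known only there. *)
Lemma eq_of_prefix_sums (V : zmodType) (f g : L -> V) x :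
  (forall y, y <= x ->
    (\sum_(z | (z <= y)%O) f z)%R = (\sum_(z | (z <= y)%O) g z)%R) ->
  f x = g x.
Proof.
elim/lt_induction: x => x IH fg; have := fg x (lexx x).
rewrite (bigD1 x) //= [in RHS](bigD1 x) //=.
rewrite [in LHS](eq_bigr g) => [/addIr //|y /andP[yx ynx]].
have ltyx : y < x by rewrite lt_neqAle ynx.
by apply: IH => // z zy; apply: fg; apply: le_trans zy yx.
Qed.

Section Rank.
Variables (rho : L -> nat) (rhoP : rank_function rho).

Lemma rank_lt z x : z < x -> (rho z < rho x)%N.
Proof.
move=> zx; have [s [ps ls]] := exists_maximal_chain (le0x z).
have [u [pu lu]] := exists_maximal_chain (ltW zx).
rewrite -(rhoP (conj ps ls)) -(@rhoP x (s ++ u)); last first.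
  by split; rewrite ?cat_path ?last_cat ls // ps.
rewrite size_cat -addn1 leq_add2l; case: u {pu} lu => //= zx'.
by rewrite zx' ltxx in zx.
Qed.

Lemma rank_le_lattice_rank x : (rho x <= lattice_rank rho)%N.
Proof. exact: (leq_bigmax x). Qed.

End Rank.

(** * Multichains and the induced blocks of atoms *)

Section Multichain.
Variables (n : nat) (C : 'I_n.+1 -> L).
Hypothesis CP : multichain C.
Implicit Types (i j l : 'I_n) (k : 'I_n.+1) (t : {ffun 'I_n -> L}).

Lemma multichain_le k k' : (k <= k')%N -> C k <= C k'.
Proof.
case: k' => m; elim: m => [|m IHm] lt_m /=.
  by rewrite leqn0 => /eqP k0; have -> : k = Ordinal lt_m by apply: val_inj.
rewrite leq_eqVlt => /predU1P[kE|].
  by have -> : k = Ordinal lt_m by apply: val_inj.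
rewrite ltnS => /(IHm (ltnW lt_m))/le_trans; apply.
case: CP => _ _ /(_ (Ordinal (lt_m : (m < n)%N))); rewrite /lower /upper.
by congr (C _ <= C _); apply: val_inj.
Qed.

Lemma index_exists x :
  x != \bot -> exists i, (x <= upper C i) && ~~ (x <= lower C i).
Proof.
case: CP => C0 C1 _ x0.
(* The least [k] with [x <= C k] is nonzero because [C ord0] is [\bot], hence it has the form
   [lift ord0 i]. *)
have: x <= C ord_max by rewrite C1 lex1.
case/(@arg_minnP _ _ (fun k => x <= C k) (@nat_of_ord _)) => k xk kmin.
case: (unliftP ord0 k) => [i kE|kE]; last by rewrite kE C0 lex0 (negPf x0) in xk.
exists i; rewrite /upper -kE xk /=; apply/negP => /kmin /=.
by rewrite kE lift0 ltnn.
Qed.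

Lemma block_upper_le l k a : a \in block C l -> a <= C k -> upper C l <= C k.
Proof.
rewrite inE => /andP[_ /andP[_ nal]] ak; apply: multichain_le; rewrite lift0.
rewrite ltnNge; apply: contra nal => kl; apply: le_trans ak _.
exact: multichain_le.
Qed.

Lemma block_inj i j a : a \in block C i -> a \in block C j -> i = j.
Proof.
move=> ai aj; apply: val_inj; apply/eqP => /=.
wlog: i j ai aj / (i <= j)%N => [hw|ij].
  by have [/hw->//|/ltnW/hw] := leqP i j; rewrite // eq_sym => ->.
rewrite eqn_leq ij leqNgt /=; apply/negP => lt_ij.
have := ai; rewrite inE => /andP[_ /andP[aui _]].
have := aj; rewrite inE => /andP[_ /andP[_ /negP]]; apply.
by apply: le_trans aui _; apply: multichain_le; rewrite lift0.
Qed.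

(** * Singleton blocks and the meet condition *)

Lemma has_singleton_block_meet x k :
  has_singleton_block C (x `&` C k) -> has_singleton_block C x.
Proof.
case=> l bl; exists l; rewrite -bl; apply: eq_card => a.
have /card_gt0P[c]: (0 < #|block C l :&: atoms_below (x `&` C k)|)%N by rewrite bl.
rewrite !inE lexI => /andP[cl /and3P[_ _ ck]].
have ulk : upper C l <= C k by apply: (block_upper_le (a := c)); rewrite ?inE.
have [/and3P[_ aul _] /=|//] := boolP [&& is_atom a, a <= upper C l & _].
by rewrite lexI (le_trans aul ulk) andbT.
Qed.

Lemma atoms_below_sub_block x i : x <= upper C i -> x `&` lower C i = \bot ->
  atoms_below x \subset block C i.
Proof.
move=> xi xi0; apply/subsetP => a; rewrite !inE => /andP[aP ax].
rewrite aP (le_trans ax xi) /=; apply: contraL (atom_neq0 aP) => ai.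
by rewrite negbK -lex0 -xi0 lexI ax.
Qed.

(** A nonzero meet with [lower C i] would be strictly below [x], so it would have a singleton block,
    which [x] would inherit. *)
Lemma minimal_no_singleton x : x != \bot -> ~ has_singleton_block C x ->
  (forall y, y < x -> y != \bot -> has_singleton_block C y) ->
  exists2 i, x <= upper C i & x `&` lower C i = \bot.
Proof.
move=> x0 nx small; have [i /andP[xi nxi]] := index_exists x0.
exists i => //; apply/eqP; apply/negPn/negP => xi0; apply: nx.
apply: (@has_singleton_block_meet _ (widen_ord (leqnSn n) i)); apply: small => //.
by rewrite lt_neqAle leIl andbT; apply: contra nxi => /eqP <-; apply: leIr.
Qed.

(** If the meet were [\bot], all atoms below [x] would lie in block [i]. Since [x] is atomic and not
    an atom, two of them differ; their join then has at least two atoms in block [i] and none in any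
    other block. *)
Lemma singleton_joins_meet_condition :
  (forall x, (exists j a b,
      [/\ a \in block C j, b \in block C j, a <> b & x = a `|` b]) ->
    has_singleton_block C x) ->
  meet_condition C.
Proof.
move=> H x [S [SP xE]] x0 nxa i xi nxi; apply/negP => /eqP xi0.
have sub := subsetP (atoms_below_sub_block xi xi0).
have SE a : a \in S -> a \in atoms_below x.
  by move=> aS; rewrite inE SP //= xE joins_sup.
have [a aS] : exists a, a \in S.
  by apply/set0Pn; apply: contraNneq x0 => S0; rewrite xE S0 big_set0.
have [b bS nab] : exists2 b, b \in S & b != a.
  apply/exists_inP; apply: contraNT nxa => /exists_inPn nb.
  suff -> : x = a by apply: SP.
  rewrite xE; apply/le_anti; rewrite joins_sup // andbT.
  by apply/joinsP => b /nb; rewrite negbK => /eqP->.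
have abx : a `|` b <= x.
  by rewrite leUx; move: (SE _ aS) (SE _ bS); rewrite !inE => /andP[_ ->] /andP[_ ->].
have [|l] := H (a `|` b).
  exists i, a, b; split=> //; [exact/sub/SE | exact/sub/SE |].
  by move=> ab; rewrite ab eqxx in nab.
move/eqP/cards1P => [c cE].
have sub_i e : e \in atoms_below (a `|` b) -> e \in block C i.
  rewrite inE => /andP[eP eab]; apply: sub.
  by rewrite inE eP (le_trans eab).
have aab : a \in atoms_below (a `|` b) by rewrite inE SP // leUl.
have bab : b \in atoms_below (a `|` b) by rewrite inE SP // leUr.
have : c \in block C l :&: atoms_below (a `|` b) by rewrite cE set11.
rewrite inE => /andP[cl /sub_i ci]; have li := block_inj cl ci.
have : a \in [set c] by rewrite -cE li inE aab sub_i.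
have : b \in [set c] by rewrite -cE li inE bab sub_i.
by rewrite !inE => /eqP bc /eqP ac; rewrite bc ac eqxx in nab.
Qed.

Lemma meet_condition_singleton : meet_condition C ->
  forall x, x != \bot -> has_singleton_block C x.
Proof.
move=> MC; elim/lt_induction => x IH x0.
(* The meet condition concerns atomic elements only; [y] is atomic and has the same atoms below it
   as [x]. *)
pose y := \join_(a in atoms_below x) a.
have yx : y <= x by apply/joinsP => a; rewrite inE => /andP[].
have yA : atoms_below y = atoms_below x.
  apply/setP => a; apply/idP/idP; rewrite ![_ \in atoms_below _]inE => /andP[aP ax].
    by rewrite aP (le_trans ax).
  by rewrite aP joins_sup // inE aP.
have [a aP ax] := atom_below x0.
have ay : a <= y by rewrite joins_sup // inE aP.
have y0 : y != \bot.
  by apply: contraNneq (atom_neq0 aP) => yE; rewrite -lex0 -yE.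
have [i /andP[yi nyi]] := index_exists y0.
suff [l] : has_singleton_block C y by rewrite yA => ?; exists l.
have [ya|nya] := boolP (is_atom y).
  exists i; apply/eqP/cards1P; exists y; apply/setP=> b; rewrite !inE.
  apply/idP/eqP => [/and3P[_ bP by_]|->]; first exact: atom_le_eq.
  by rewrite ya yi nyi lexx.
have yat : atomic y by exists (atoms_below x); split=> // b; rewrite inE => /andP[].
have := MC y yat y0 nya i yi nyi => yi0.
apply: (@has_singleton_block_meet _ (widen_ord (leqnSn n) i)); apply: IH yi0.
apply: lt_le_trans yx.
by rewrite lt_neqAle leIl andbT; apply: contra nyi => /eqP <-; apply: leIr.
Qed.

(** * The products P, the sums S and the Möbius function *)

Definition block_product x : int :=
  (\prod_(i < n) (1 - #|block C i :&: atoms_below x|%:R))%R.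

Definition signed_transversals y : int :=
  (\sum_(t in transversals C y) (-1) ^+ #|supp t|)%R.

(** Each factor is a sum of weights over [\bot |: B i]: [u] for [\bot] and -1 for each element of
    [B i]; then distribute. It serves with [u] equal to 1 and to the indeterminate. *)
Lemma prod_sub_card (R : comNzRingType) (u : R) (B : 'I_n -> {set L}) :
  (forall i, \bot \notin B i) ->
  (\prod_(i < n) (u - #|B i|%:R) =
   \sum_(t : {ffun 'I_n -> L} | [forall i, t i \in \bot |: B i])
     (-1) ^+ #|supp t| * u ^+ (n - #|supp t|))%R.
Proof.
move=> B0.
pose w a : R := (if a == \bot then u else -1)%R.
rewrite (eq_bigr (fun i => \sum_(a in \bot |: B i) w a)%R); last first.
  move=> i _; rewrite big_setU1 //= /w eqxx; congr (_ + _)%R.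
  rewrite (eq_bigr (fun=> -1)%R) ?sumr_const ?mulNrn // => a aB.
  by rewrite ifN //; apply: contraNneq (B0 i) => <-.
rewrite bigA_distr_big_dep; apply: eq_big => [t|t _].
  by apply/familyP/forallP => H i; apply: H.
rewrite (bigID (mem (supp t))) /=; congr (_ * _)%R.
  rewrite (eq_bigr (fun=> -1)%R) ?prodr_const // => i.
  by rewrite inE /w => /negPf->.
rewrite (eq_bigr (fun=> u)) => [|i]; last by rewrite inE negbK /w => ->.
rewrite (eq_bigl (mem (~: supp t))) => [|i]; last by rewrite !inE.
by rewrite prodr_const cardsCs setCK card_ord.
Qed.

Lemma bot_notin_block i : \bot \notin block C i.
Proof. by rewrite inE !le0x andbF. Qed.

Lemma signed_transversals_sum x :
  (\sum_(y | (y <= x)%O) signed_transversals y)%R = block_product x.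
Proof.
rewrite /block_product (prod_sub_card 1%R); last first.
  by move=> i; rewrite inE (negPf (bot_notin_block i)).
(* Group the choices by their join [y]: a transversal uses only atoms below [x] exactly when
   [y <= x]. *)
rewrite (partition_big (fun t : {ffun 'I_n -> L} => \join_(i < n) t i)
           (fun y => y <= x)) /= => [|t /forallP tP]; last first.
  apply/joinsP => i _; have := tP i; rewrite !inE.
  by case/predU1P=> [->|/and3P[]]; rewrite ?le0x.
apply: eq_bigr => y yx; apply: eq_big => [t|t _]; last by rewrite expr1n mulr1.
rewrite inE; have [tE|] := eqVneq _ y; rewrite ?andbF ?andbT //.
apply: eq_forallb => i; rewrite !inE; have [//|_ /=] := eqVneq (t i) \bot.
have tix : t i <= x by apply: le_trans yx; rewrite -tE joins_sup.
by rewrite tix; case: (is_atom _); rewrite ?andbF ?andbT.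
Qed.

Lemma block_product_eq0 x : block_product x = 0%R <-> has_singleton_block C x.
Proof.
split=> [/eqP/prodf_eq0[i _]|[i ci]].
  by rewrite subr_eq0 eq_sym pnatr_eq1 => /eqP; exists i.
by apply/eqP/prodf_eq0; exists i => //; rewrite ci subrr.
Qed.

Lemma block_product_bot : block_product \bot = 1%R.
Proof.
rewrite /block_product big1 // => i _; rewrite eq_card0 ?subr0 // => a.
rewrite !inE lex0; apply: contraTF (bot_notin_block i) => /and3P[aC _ /eqP a0].
by rewrite negbK inE -a0.
Qed.

Lemma mobius_eq_signed x :
  (forall y, y <= x -> y != \bot -> has_singleton_block C y) ->
  mobius x = signed_transversals x.
Proof.
move=> sing; apply: eq_of_prefix_sums => y yx.
rewrite mobius_sum signed_transversals_sum.
have [->|y0] := eqVneq y \bot; first by rewrite block_product_bot.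
by apply/esym/block_product_eq0/sing.
Qed.

(* When all atoms below [x] lie in block [i], the product has the single
   nontrivial factor [1 - #|atoms_below x|]. *)
Lemma minimal_block_product_le0 x : x != \bot ->
  (forall y, y < x -> y != \bot -> has_singleton_block C y) ->
  (block_product x <= 0)%R.
Proof.
move=> x0 small; have [->//|/eqP px] := eqVneq (block_product x) 0%R.
have nx : ~ has_singleton_block C x by move/block_product_eq0.
have [i xi xi0] := minimal_no_singleton x0 nx small.
have sub := subsetP (atoms_below_sub_block xi xi0).
have [a aP ax] := atom_below x0.
have aA : a \in atoms_below x by rewrite inE aP.
rewrite /block_product (bigD1 i) //= big1 => [|j ji]; last first.
  rewrite eq_card0 ?subr0 // => b; rewrite in_setI; apply/negP => /andP[bj /sub bi].
  by rewrite (block_inj bj bi) eqxx in ji.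
rewrite mulr1 subr_le0 ler1n.
by apply/card_gt0P; exists a; rewrite in_setI aA sub.
Qed.

(** * The characteristic polynomial under the support hypothesis *)

Section SupportRank.
Variables (rho : L -> nat) (rhoP : rank_function rho).
Hypothesis supp_rho :
  forall y t, t \in transversals C y -> #|supp t| = rho y.

Lemma tofrac_block_poly :
  (tofrac 'X ^ ((lattice_rank rho)%:Z - n%:Z) *
     \prod_(i < n) tofrac ('X - #|block C i|%:R) =
   tofrac (\sum_(y : L) signed_transversals y *:
             'X^(lattice_rank rho - rho y)) :> {fraction {poly int}})%R.
Proof.
set T := (tofrac 'X : {fraction {poly int}}).
have T0 : T != 0%R by rewrite tofrac_eq0 polyX_eq0.
rewrite (eq_bigr (fun i => T - #|block C i|%:R)%R); last first.
  by move=> i _; rewrite tofracB tofracMn tofrac1.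
rewrite (prod_sub_card T bot_notin_block) mulr_sumr rmorph_sum /=.
rewrite (partition_big (fun t : {ffun 'I_n -> L} => \join_(i < n) t i) predT) //=.
apply: eq_bigr => y _; rewrite scaler_suml rmorph_sum /=.
apply: eq_big => [t|t /andP[tA tE]]; first by rewrite inE.
(* The exponent [n - #|supp t|] becomes [n - rho y]. As [rho y <= n], this is a true difference, and
   the shift by the rank of [L] minus [n] cancels [n]. *)
have sy : #|supp t| = rho y by apply: supp_rho; rewrite inE tE andbT.
have le_n : (#|supp t| <= n)%N by have := max_card (mem (supp t)); rewrite card_ord.
rewrite sy in le_n *.
have -> : (((-1) ^+ rho y *: 'X^(lattice_rank rho - rho y)) =
   ((-1) ^+ rho y * 'X^(lattice_rank rho - rho y)) :> {poly int})%R.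
  by rewrite -mul_polyC rmorphXn /= rmorphN1.
rewrite tofracM !tofracXn tofracN tofrac1 -/T mulrCA; congr (_ * _)%R.
rewrite !exprnP -expfzDr //; congr (_ ^ _)%R.
rewrite -!subzn ?rank_le_lattice_rank //.
by rewrite addrA subrK.
Qed.

Lemma characteristic_poly_rank_sums :
  characteristic_poly rho =
    (\sum_(y : L) signed_transversals y *: 'X^(lattice_rank rho - rho y))%R ->
  forall k : nat, (\sum_(y | rho y == k) mobius y =
             \sum_(y | rho y == k) signed_transversals y)%R.
Proof.
move=> eq_chi k.
have [lek|ltk] := leqP k (lattice_rank rho); last first.
  by rewrite !big1 // => y /eqP yk;
     move: (rank_le_lattice_rank rho y); rewrite yk leqNgt ltk.
have coefE (f : L -> int) : ((\sum_(y : L) f y *: 'X^(lattice_rank rho - rho y))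
    `_(lattice_rank rho - k) = \sum_(y | rho y == k) f y)%R.
  rewrite coef_sum [RHS]big_mkcond; apply: eq_bigr => y _.
  rewrite coefZ coefXn.
  (* Truncated subtraction is injective here, both [k] and [rho y] being at most the rank of [L]. *)
  have -> : (lattice_rank rho - k == lattice_rank rho - rho y)%N = (rho y == k).
    apply/eqP/eqP => [e|->//].
    by rewrite -(subKn lek) e subKn // rank_le_lattice_rank.
  by case: eqP; rewrite ?mulr1 ?mulr0.
by rewrite -!coefE -eq_chi.
Qed.

Lemma rank_sums_singleton :
  (forall k : nat, (\sum_(y | rho y == k) mobius y =
              \sum_(y | rho y == k) signed_transversals y)%R) ->
  forall x, x != \bot -> has_singleton_block C x.
Proof.
move=> eq_k x; have [m] := ubnP (rho x); elim: m x => // m IHm.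
have small x : (rho x <= m)%N -> forall y, y < x -> y != \bot ->
    has_singleton_block C y.
  by move=> xm y yx; apply: IHm; apply: leq_trans xm; apply: rank_lt yx.
(* Strictly below [x] the two functions agree, so their difference at [x] is that of their sums over
   all [y <= x], namely 0 minus [block_product x]. *)
have diff x : (rho x <= m)%N -> x != \bot ->
    (mobius x - signed_transversals x = - block_product x)%R.
  move=> xm x0; have := mobius_sum x; rewrite (negPf x0) (bigD1 x) //=.
  rewrite -signed_transversals_sum (bigD1 x (P := fun y => y <= x)) //=.
  rewrite (eq_bigr signed_transversals) => [|y /andP[yx ynx]]; last first.
    apply: mobius_eq_signed => z zy; apply: small xm _ _.
    by apply: le_lt_trans zy _; rewrite lt_neqAle ynx.
  by rewrite mulr0n => /addr0_eq <-; rewrite opprB.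
move=> x; rewrite ltnS => xm x0; apply/block_product_eq0.
have rank0 y : rho y == rho x -> y != \bot.
  move=> /eqP yx; apply: contraTneq (rank_lt rhoP (_ : \bot < x)) => [y0|].
    by rewrite -y0 yx ltnn.
  by rewrite lt0x.
(* Over the rank of [x], the terms [- block_product y] are nonnegative and sum to 0, so each one
   vanishes. *)
apply: oppr_inj; rewrite oppr0.
have /(psumr_eq0P (P := fun y => rho y == rho x)
        (F := fun y => (- block_product y)%R)) :
    forall y, rho y == rho x -> (0 <= - block_product y)%R.
  move=> y yx; rewrite oppr_ge0; apply: minimal_block_product_le0.
    exact: rank0.
  by apply: small; rewrite (eqP yx).
apply => //.
rewrite (eq_bigr (fun y => mobius y - signed_transversals y)%R); last first.
  by move=> y yx; rewrite diff ?rank0 // (eqP yx).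
by rewrite sumrB eq_k subrr.
Qed.

End SupportRank.
End Multichain.
End FiniteLattice.

(* Clause (4) is an identity of rational functions, as the exponent
   rho(L) - n may be negative (blocks may be empty). *)
Theorem theorem5p4 (d : Order.disp_t) (L : finTBLatticeType d)
  (rho : L -> nat) (n : nat) (C : 'I_n.+1 -> L)
  (rhoP : rank_function rho) (CP : multichain C)
  (supp_rho : forall (y : L) (t : {ffun 'I_n -> L}),
     t \in transversals C y -> #|supp t| = rho y) :
  [<-> forall x : L, x <> Order.bottom -> has_singleton_block C x;
       forall x : L,
         (exists (j : 'I_n) (a b : L),
            [/\ a \in block C j, b \in block C j, a <> b & x = Order.join a b]) ->
         has_singleton_block C x;
       meet_condition C;
       (tofrac (characteristic_poly rho) =
          tofrac 'X ^ ((lattice_rank rho)%:Z - n%:Z) *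
          \prod_(i < n) tofrac ('X - #|block C i|%:R)
        :> {fraction {poly int}})%R].
Proof.
rewrite (tofrac_block_poly supp_rho); tfae.
- move=> sing x [j [a [b [aj _ _ ->]]]]; apply: sing => ab0.
  have := leUl a b; rewrite ab0 lex0 => /eqP a0.
  by move: (bot_notin_block C j); rewrite -a0 aj.
- exact: singleton_joins_meet_condition.
- move=> /(meet_condition_singleton CP) sing; congr (tofrac _).
  by apply: eq_bigr => x _; rewrite (@mobius_eq_signed _ _ _ C) // => y _; apply: sing.
- move/eqP; rewrite tofrac_eq => /eqP /characteristic_poly_rank_sums eq_k x /eqP.
  exact: rank_sums_singleton eq_k x.
Qed.
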